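(* Let $f_c>0$, $\omega_c = 2\pi f_c$, and let $g:\mathbb{R}\to\mathbb{R}$ be either $g(x)=|x|$ (full-wave rectifier) or $g(x)=\max(0,x)$ (half-wave rectifier). Let $a_k$ ($k\ge 0$) and $b_k$ ($k\ge 1$) be the trigonometric Fourier coefficients of the periodic function $t\mapsto g(\cos(\omega_c t))$, as defined in the context. Then: (i) For the full-wave rectifier $g(x)=|x|$, $$a_1 = 0,\qquad a_k = \frac{4}{\pi(1-k^2)}\cos\left(\frac{\pi k}{2}\right)\quad\text{for all integers } k\ge 0,\ k\neq 1.$$ (ii) For the half-wave rectifier $g(x)=\max(0,x)$, $$a_1 = \frac12,\qquad a_k = \frac{2}{\pi(1-k^2)}\cos\left(\frac{\pi k}{2}\right)\quad\text{for all integers } k\ge 0,\ k\neq 1.$$ (iii) In both cases, $b_k=0$ for all $k$.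
   Context: The trigonometric Fourier coefficients are defined by $$a_k = 2f_c\int_{-\frac{1}{2f_c}}^{\frac{1}{2f_c}} g(\cos(2\pi f_c t))\cos(2\pi k f_c t)\,dt,\qquad b_k = 2f_c\int_{-\frac{1}{2f_c}}^{\frac{1}{2f_c}} g(\cos(2\pi f_c t))\sin(2\pi k f_c t)\,dt,$$ so that the Fourier series of $g(\cos(\omega_c t))$ is $\frac{a_0}{2}+\sum_{k=1}^\infty [a_k\cos(\omega_c k t)+b_k\sin(\omega_c k t)]$. *)

(* Defs.v *)
From Stdlib Require Import Reals.
From Coquelicot Require Import Coquelicot.

Open Scope R_scope.

Definition full_wave (x : R) : R := Rabs x.

Definition half_wave (x : R) : R := Rmax 0 x.

(* Trigonometric Fourier coefficients of [fun t => g (cos (2 * PI * fc * t))],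
   over one period [1 / fc], normalised so that the constant term of the
   series is [fourier_a g fc 0 / 2]. *)
Definition fourier_a (g : R -> R) (fc : R) (k : nat) : R :=
  2 * fc *
  RInt (fun t => g (cos (2 * PI * fc * t)) * cos (2 * PI * INR k * fc * t))
       (- (1 / (2 * fc))) (1 / (2 * fc)).

Definition fourier_b (g : R -> R) (fc : R) (k : nat) : R :=
  2 * fc *
  RInt (fun t => g (cos (2 * PI * fc * t)) * sin (2 * PI * INR k * fc * t))
       (- (1 / (2 * fc))) (1 / (2 * fc)).

(* Main.v *)
Require Import Defs.
From Stdlib Require Import Reals Lra.
From Coquelicot Require Import Coquelicot.

Open Scope R_scope.

(** Rescaling by [x = 2 * PI * fc * t] turns the coefficients into integrals
    over [[-PI, PI]], split at the sign changes [-PI/2] and [PI/2] of the cosine.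
    On each piece both rectifiers are linear, so an antiderivative of
    [cos x * cos (k x)] evaluates the integral; the sine coefficients vanish
    because their integrand is odd. *)

Lemma is_RInt_rescale (fc : R) (hfc : 0 < fc) (f : R -> R) (l : R) :
  is_RInt f (- PI) PI l ->
  2 * fc * RInt (fun t => f (2 * PI * fc * t)) (- (1 / (2 * fc))) (1 / (2 * fc))
  = l / PI.
Proof.
  intros H.
  pose proof PI_RGT_0 as hpi.
  assert (E : is_RInt (fun t => f (2 * PI * fc * t))
                (- (1 / (2 * fc))) (1 / (2 * fc)) (/ (2 * PI * fc) * l)).
  (* The linear substitution rule needs the slope [2 * PI * fc] as a factor of the integrand, so it
     is inserted and cancelled by its inverse. *)
  { apply is_RInt_ext with
      (fun t => scal (/ (2 * PI * fc))
                  (scal (2 * PI * fc) (f (2 * PI * fc * t + 0)))).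
    { intros t _. rewrite Rplus_0_r. unfold scal; simpl; unfold mult; simpl.
      field. lra. }
    apply (is_RInt_scal (V := R_NormedModule)).
    apply (is_RInt_comp_lin f).
    replace (2 * PI * fc * - (1 / (2 * fc)) + 0) with (- PI) by (field; lra).
    replace (2 * PI * fc * (1 / (2 * fc)) + 0) with PI by (field; lra).
    exact H. }
  rewrite (is_RInt_unique _ _ _ _ E). field. lra.
Qed.

(** Transfers continuity from the absolute value to the half-wave rectifier. *)
Lemma half_wave_abs (x : R) : half_wave x = (x + full_wave x) / 2.
Proof.
  unfold half_wave, full_wave, Rmax, Rabs.
  destruct (Rle_dec 0 x), (Rcase_abs x); lra.
Qed.

Lemma continuous_full_wave (x : R) : continuous full_wave x.
Proof. apply continuous_Rabs. Qed.

Lemma continuous_half_wave (x : R) : continuous half_wave x.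
Proof.
  apply continuous_ext with (fun y => scal (/ 2) (plus y (full_wave y))).
  { intros y. rewrite half_wave_abs. unfold scal, plus; simpl.
    unfold mult; simpl. lra. }
  apply (continuous_scal_r (V := R_NormedModule)).
  apply (continuous_plus (V := R_NormedModule)).
  - apply continuous_id.
  - apply continuous_full_wave.
Qed.

Section Antiderivative.

Variables (f H : R -> R).
Hypothesis derive_H : forall x, is_derive H x (cos x * f x).
Hypothesis continuous_f : forall x, continuous f x.

Lemma is_RInt_linear_on (g : R -> R) (c a b : R) :
  a <= b ->
  (forall x, a < x < b -> g (cos x) = c * cos x) ->
  is_RInt (fun x => g (cos x) * f x) a b (c * (H b - H a)).
Proof.
  intros hab hg.
  apply is_RInt_ext with (fun x => scal c (cos x * f x)).
  { intros x. rewrite Rmin_left, Rmax_right by lra. intros hx.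
    rewrite hg by lra. unfold scal; simpl; unfold mult; simpl. ring. }
  apply (is_RInt_scal (V := R_NormedModule)).
  apply (is_RInt_derive (V := R_CompleteNormedModule) H (fun x => cos x * f x)).
  - intros x _. apply derive_H.
  - intros x _. apply (continuous_mult (K := R_AbsRing)).
    + apply continuous_cos.
    + apply continuous_f.
Qed.

(** The slopes [p] and [q] treat both rectifiers at once: full wave is [(1, -1)], half wave is
    [(1, 0)]. The two outer pieces, where the cosine is nonpositive, are grouped as the whole period
    minus the middle piece. *)
Lemma is_RInt_piecewise_linear (g : R -> R) (p q : R) :
  (forall y, 0 <= y -> g y = p * y) ->
  (forall y, y <= 0 -> g y = q * y) ->
  is_RInt (fun x => g (cos x) * f x) (- PI) PI
    (p * (H (PI / 2) - H (- (PI / 2))) +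
     q * ((H PI - H (- PI)) - (H (PI / 2) - H (- (PI / 2))))).
Proof.
  intros hp hq. pose proof PI_RGT_0 as hpi.
  replace (p * (H (PI / 2) - H (- (PI / 2))) +
           q * ((H PI - H (- PI)) - (H (PI / 2) - H (- (PI / 2)))))
    with (plus (plus (q * (H (- (PI / 2)) - H (- PI)))
                     (p * (H (PI / 2) - H (- (PI / 2)))))
               (q * (H PI - H (PI / 2)))) by (unfold plus; simpl; ring).
  apply (is_RInt_Chasles (V := R_NormedModule)) with (PI / 2).
  apply (is_RInt_Chasles (V := R_NormedModule)) with (- (PI / 2)).
  - apply is_RInt_linear_on; [lra|]. intros x hx. apply hq.
    (* Evenness moves the left piece to [[PI/2, PI]], within the range that [cos_le_0] covers. *)
    rewrite <- cos_neg. apply cos_le_0; lra.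
  - apply is_RInt_linear_on; [lra|]. intros x hx. apply hp.
    apply cos_ge_0; lra.
  - apply is_RInt_linear_on; [lra|]. intros x hx. apply hq.
    apply cos_le_0; lra.
Qed.

End Antiderivative.

Lemma fourier_a_piecewise_linear (fc : R) (hfc : 0 < fc) (k : nat)
    (H g : R -> R) (p q : R) :
  (forall x, is_derive H x (cos x * cos (INR k * x))) ->
  (forall y, 0 <= y -> g y = p * y) ->
  (forall y, y <= 0 -> g y = q * y) ->
  fourier_a g fc k =
    (p * (H (PI / 2) - H (- (PI / 2))) +
     q * ((H PI - H (- PI)) - (H (PI / 2) - H (- (PI / 2))))) / PI.
Proof.
  intros dH hp hq. unfold fourier_a.
  rewrite <- (is_RInt_rescale fc hfc (fun x => g (cos x) * cos (INR k * x))).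
  - f_equal. apply RInt_ext. intros t _. do 2 f_equal. ring.
  - apply (is_RInt_piecewise_linear (fun x => cos (INR k * x))); try assumption.
    intros x. apply (continuous_comp (fun y => INR k * y) cos).
    + apply (ex_derive_continuous (V := R_NormedModule)). auto_derive. exact I.
    + apply continuous_cos.
Qed.

Lemma full_wave_nonneg (y : R) : 0 <= y -> full_wave y = 1 * y.
Proof. intros hy. unfold full_wave. rewrite Rabs_pos_eq; lra. Qed.

Lemma full_wave_nonpos (y : R) : y <= 0 -> full_wave y = -1 * y.
Proof. intros hy. unfold full_wave. rewrite Rabs_left1; lra. Qed.

Lemma half_wave_nonneg (y : R) : 0 <= y -> half_wave y = 1 * y.
Proof. intros hy. unfold half_wave. rewrite Rmax_right; lra. Qed.

Lemma half_wave_nonpos (y : R) : y <= 0 -> half_wave y = 0 * y.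
Proof. intros hy. unfold half_wave. rewrite Rmax_left; lra. Qed.

Lemma sin_INR_PI (n : nat) : sin (INR n * PI) = 0.
Proof.
  apply sin_eq_0_1. exists (Z.of_nat n). now rewrite <- INR_IZR_INZ.
Qed.

(** Obtained by integrating the product-to-sum form [(cos ((k + 1) * x) + cos ((k - 1) * x)) / 2]
    term by term; an antiderivative only when [k] is neither 1 nor -1. *)
Definition cos_cos_primitive (k x : R) : R :=
  (sin ((k + 1) * x) / (k + 1) + sin ((k - 1) * x) / (k - 1)) / 2.

Lemma is_derive_cos_cos_primitive (k x : R) :
  k + 1 <> 0 -> k - 1 <> 0 ->
  is_derive (cos_cos_primitive k) x (cos x * cos (k * x)).
Proof.
  intros h1 h2. unfold cos_cos_primitive. auto_derive; [exact I|].
  replace ((k + 1) * x) with (k * x + x) by ring.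
  replace ((k - 1) * x) with (k * x - x) by ring.
  rewrite cos_plus, cos_minus. field. split; assumption.
Qed.

Lemma cos_cos_primitive_opp (k x : R) :
  cos_cos_primitive k (- x) = - cos_cos_primitive k x.
Proof.
  unfold cos_cos_primitive.
  rewrite !Ropp_mult_distr_r_reverse, !sin_neg. unfold Rdiv. ring.
Qed.

(** Both numerators are sines of integer multiples of [PI], so the quotients vanish whatever the
    denominators. *)
Lemma cos_cos_primitive_PI (k : nat) : cos_cos_primitive (INR k) PI = 0.
Proof.
  unfold cos_cos_primitive.
  rewrite !Rmult_plus_distr_r, Rmult_minus_distr_r, Rmult_1_l.
  rewrite neg_sin, sin_minus, sin_PI, sin_INR_PI. unfold Rdiv. ring.
Qed.

(** The quarter-turn shifts turn the sines into [cos (PI * k / 2)] and its opposite, and [1 / (k +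
    1) - 1 / (k - 1) = 2 / (1 - k ^ 2)]. *)
Lemma cos_cos_primitive_PI2 (k : R) :
  k + 1 <> 0 -> k - 1 <> 0 ->
  cos_cos_primitive k (PI / 2) = cos (PI * k / 2) / (1 - k ^ 2).
Proof.
  intros h1 h2. unfold cos_cos_primitive.
  replace ((k + 1) * (PI / 2)) with (PI * k / 2 + PI / 2) by field.
  replace ((k - 1) * (PI / 2)) with (PI * k / 2 - PI / 2) by field.
  rewrite sin_plus, sin_minus, sin_PI2, cos_PI2.
  field. repeat split; try assumption.
  replace (1 - k ^ 2) with (- ((k + 1) * (k - 1))) by ring.
  now apply Ropp_neq_0_compat, Rmult_integral_contrapositive_currified.
Qed.

(** The primitive [H] is odd and vanishes at [PI], so the piecewise formula collapses to
    [2 * (p - q) * H (PI / 2) / PI]. The slope gap [p - q] is 2 for the full wave and 1 for the half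
    wave. *)
Lemma fourier_a_piecewise_linear_ne1 (fc : R) (hfc : 0 < fc) (k : nat)
    (g : R -> R) (p q : R) :
  k <> 1%nat ->
  (forall y, 0 <= y -> g y = p * y) ->
  (forall y, y <= 0 -> g y = q * y) ->
  fourier_a g fc k =
    2 * (p - q) / (PI * (1 - INR k ^ 2)) * cos (PI * INR k / 2).
Proof.
  intros hk hp hq.
  assert (h1 : INR k + 1 <> 0) by (pose proof (pos_INR k); lra).
  assert (h2 : INR k - 1 <> 0).
  { intros e. apply hk, INR_eq. simpl. lra. }
  rewrite (fourier_a_piecewise_linear fc hfc k (cos_cos_primitive (INR k)) g p q);
    try assumption.
  2: { intros x. now apply is_derive_cos_cos_primitive. }
  rewrite !cos_cos_primitive_opp, cos_cos_primitive_PI.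
  rewrite cos_cos_primitive_PI2 by assumption.
  field. split; [|apply PI_neq0].
  replace (1 - INR k ^ 2) with (- ((INR k + 1) * (INR k - 1))) by ring.
  now apply Ropp_neq_0_compat, Rmult_integral_contrapositive_currified.
Qed.

(** Here the general primitive would divide by [k - 1 = 0], so [cos x ^ 2] gets its own,
    [(x + sin x * cos x) / 2]. Each half period then contributes [PI / 2] times its slope. *)
Lemma fourier_a_piecewise_linear_1 (fc : R) (hfc : 0 < fc) (g : R -> R) (p q : R) :
  (forall y, 0 <= y -> g y = p * y) ->
  (forall y, y <= 0 -> g y = q * y) ->
  fourier_a g fc 1 = (p + q) / 2.
Proof.
  intros hp hq.
  rewrite (fourier_a_piecewise_linear fc hfc 1
             (fun x => (x + sin x * cos x) / 2) g p q); try assumption.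
  - rewrite !sin_neg, !cos_neg, sin_PI, cos_PI2. field. apply PI_neq0.
  - intros x. auto_derive; [exact I|].
    simpl INR. rewrite !Rmult_1_l.
    pose proof (sin2_cos2 x) as e. unfold Rsqr in e. lra.
Qed.

(** Substituting [- x] for [x] shows that the integral equals its own opposite. *)
Lemma RInt_odd (f : R -> R) (a : R) :
  (forall x, continuous f x) -> (forall x, f (- x) = - f x) ->
  RInt f (- a) a = 0.
Proof.
  intros cf of.
  assert (ef : ex_RInt f (- a) a).
  { apply (ex_RInt_continuous (V := R_CompleteNormedModule)). intros x _. apply cf. }
  apply (RInt_correct (V := R_CompleteNormedModule)) in ef.
  assert (E : is_RInt f (- a) a (opp (RInt f (- a) a))).
  { apply is_RInt_ext with (fun y => opp (f (- y))).
    { intros x _. rewrite of. unfold opp; simpl. ring. }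
    (* The substitution absorbs the sign in the integrand and reverses the bounds; swapping them
       back yields the opposite value. *)
    apply (is_RInt_comp_opp (V := R_NormedModule)).
    rewrite Ropp_involutive.
    now apply (is_RInt_swap (V := R_NormedModule)). }
  apply (is_RInt_unique (V := R_CompleteNormedModule)) in E. unfold opp in E; simpl in E. lra.
Qed.

(** An even factor, [g] of a cosine, times an odd sine is odd in [t], and the interval is
    symmetric. *)
Lemma fourier_b_eq_0 (g : R -> R) (fc : R) (k : nat) :
  (forall x, continuous g x) -> fourier_b g fc k = 0.
Proof.
  intros cg. unfold fourier_b. rewrite RInt_odd; [ring| |].
  - intros t. apply (continuous_mult (K := R_AbsRing)).
    + apply (continuous_comp (fun t => cos (2 * PI * fc * t)) g).
      * apply (ex_derive_continuous (V := R_NormedModule)). auto_derive. exact I.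
      * apply cg.
    + apply (ex_derive_continuous (V := R_NormedModule)). auto_derive. exact I.
  - intros t. rewrite !Ropp_mult_distr_r_reverse, cos_neg, sin_neg. ring.
Qed.

Theorem proposition1 (fc : R) (hfc : 0 < fc) :
  (fourier_a full_wave fc 1 = 0 /\
   forall k : nat, k <> 1%nat ->
     fourier_a full_wave fc k =
       4 / (PI * (1 - INR k ^ 2)) * cos (PI * INR k / 2)) /\
  (fourier_a half_wave fc 1 = 1 / 2 /\
   forall k : nat, k <> 1%nat ->
     fourier_a half_wave fc k =
       2 / (PI * (1 - INR k ^ 2)) * cos (PI * INR k / 2)) /\
  (forall k : nat, (1 <= k)%nat ->
     fourier_b full_wave fc k = 0 /\ fourier_b half_wave fc k = 0).
Proof.
  pose proof full_wave_nonneg as fp. pose proof full_wave_nonpos as fn.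
  pose proof half_wave_nonneg as hp. pose proof half_wave_nonpos as hn.
  repeat split.
  - rewrite (fourier_a_piecewise_linear_1 fc hfc _ _ _ fp fn). field.
  - intros k hk.
    rewrite (fourier_a_piecewise_linear_ne1 fc hfc k _ _ _ hk fp fn).
    do 2 f_equal. ring.
  - rewrite (fourier_a_piecewise_linear_1 fc hfc _ _ _ hp hn). field.
  - intros k hk.
    rewrite (fourier_a_piecewise_linear_ne1 fc hfc k _ _ _ hk hp hn).
    do 2 f_equal. ring.
  - apply fourier_b_eq_0, continuous_full_wave.
  - apply fourier_b_eq_0, continuous_half_wave.
Qed.
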